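(* For all rational numbers $n_1,p,q$, define $$\begin{aligned} x_1&=(2p^2+6q^2)n_1^2-(p^2+6pq-3q^2)n_1-p^2-3q^2,\\ x_2&=2(p+q)(p-3q)n_1^2-(3p^2+9q^2)n_1+(p+q)(p-3q),\\ x_3&=8pqn_1^2+(p^2+3q^2)n_1-(p+3q)(p-q),\\ y_1&=(2p^2+6q^2)n_1^2-3(p+q)(p-3q)n_1+p^2+3q^2,\\ y_2&=8pqn_1^2-(p^2+3q^2)n_1+(p+q)(p-3q),\\ y_3&=2(p+q)(p-3q)n_1^2-(p^2+3q^2)n_1-(p+3q)(p-q), \end{aligned}$$ and $x_4=-x_3$, $x_5=-x_2$, $x_6=-x_1$, $y_4=-y_3$, $y_5=-y_2$, $y_6=-y_1$. Then $$\sum_{i=1}^6x_i^r=\sum_{i=1}^6y_i^r\qquad\text{for } r=1,2,3,4,5.$$ Moreover, as a parametric solution this is nontrivial: in $\mathbb{Q}[n_1,p,q]$ the multisets $\{x_1,\dots,x_6\}$ and $\{y_1,\dots,y_6\}$ are distinct.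
   Context: An ideal solution of the Tarry-Escott problem of degree $k$ consists of two distinct multisets $\{x_1,\dots,x_{k+1}\}$, $\{y_1,\dots,y_{k+1}\}$ with $\sum x_i^r=\sum y_i^r$ for $r=1,\dots,k$. *)

(* Defs.v *)
From mathcomp Require Import all_boot all_order all_algebra.
From mathcomp Require Export mpoly.

Set Implicit Arguments.
Unset Strict Implicit.
Unset Printing Implicit Defensive.

Import GRing.Theory.
Local Open Scope ring_scope.

(* The six forms are defined over an arbitrary commutative ring so that the
   same expressions can be evaluated at rational numbers and at the
   indeterminates of the polynomial ring {mpoly rat[3]}. *)
Section TarryEscottForms.

Variable R : comNzRingType.

Definition x1 (n1 p q : R) : R :=
  (2 * p ^+ 2 + 6 * q ^+ 2) * n1 ^+ 2
  - (p ^+ 2 + 6 * p * q - 3 * q ^+ 2) * n1 - p ^+ 2 - 3 * q ^+ 2.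

Definition x2 (n1 p q : R) : R :=
  2 * (p + q) * (p - 3 * q) * n1 ^+ 2
  - (3 * p ^+ 2 + 9 * q ^+ 2) * n1 + (p + q) * (p - 3 * q).

Definition x3 (n1 p q : R) : R :=
  8 * p * q * n1 ^+ 2 + (p ^+ 2 + 3 * q ^+ 2) * n1 - (p + 3 * q) * (p - q).

Definition y1 (n1 p q : R) : R :=
  (2 * p ^+ 2 + 6 * q ^+ 2) * n1 ^+ 2
  - 3 * (p + q) * (p - 3 * q) * n1 + p ^+ 2 + 3 * q ^+ 2.

Definition y2 (n1 p q : R) : R :=
  8 * p * q * n1 ^+ 2 - (p ^+ 2 + 3 * q ^+ 2) * n1 + (p + q) * (p - 3 * q).

Definition y3 (n1 p q : R) : R :=
  2 * (p + q) * (p - 3 * q) * n1 ^+ 2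
  - (p ^+ 2 + 3 * q ^+ 2) * n1 - (p + 3 * q) * (p - q).

Definition xs (n1 p q : R) : seq R :=
  [:: x1 n1 p q; x2 n1 p q; x3 n1 p q;
      - x3 n1 p q; - x2 n1 p q; - x1 n1 p q].

Definition ys (n1 p q : R) : seq R :=
  [:: y1 n1 p q; y2 n1 p q; y3 n1 p q;
      - y3 n1 p q; - y2 n1 p q; - y1 n1 p q].

End TarryEscottForms.

Definition Xn1 : {mpoly rat[3]} := 'X_(inord 0).
Definition Xp : {mpoly rat[3]} := 'X_(inord 1).
Definition Xq : {mpoly rat[3]} := 'X_(inord 2).

(* Main.v *)
Require Import Defs.
From mathcomp Require Import all_boot all_order all_algebra.
From mathcomp Require Import mpoly.
From mathcomp Require Import ring.

Import GRing.Theory.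
Local Open Scope ring_scope.

(** Odd power sums vanish on both sides because entries pair off as [x], [- x]; for [r = 2, 4]
    equality is a polynomial identity, checked by expansion. Equal multisets of polynomials stay
    equal under evaluation, so one separating rational point proves distinctness. *)

Lemma sum_xs_ys (R : comNzRingType) (n1 p q : R) (r : nat) : (1 <= r <= 5)%N ->
  \sum_(x <- xs n1 p q) x ^+ r = \sum_(y <- ys n1 p q) y ^+ r.
Proof.
rewrite /xs /ys !big_cons !big_nil.
rewrite /x1 /x2 /x3 /y1 /y2 /y3.
by case: r => [|[|[|[|[|[|r]]]]]] // _; ring.
Qed.

Section Morphism.

Variables (R S : comNzRingType) (f : {rmorphism R -> S}).

(** The forms have integer coefficients, so a ring morphism, here evaluation at a point, acts only
    on the arguments. *)
Lemma map_xs (n1 p q : R) : map f (xs n1 p q) = xs (f n1) (f p) (f q).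
Proof. by rewrite /= /xs /x1 /x2 /x3 /=; repeat (congr (_ :: _)); ring. Qed.

Lemma map_ys (n1 p q : R) : map f (ys n1 p q) = ys (f n1) (f p) (f q).
Proof. by rewrite /= /ys /y1 /y2 /y3 /=; repeat (congr (_ :: _)); ring. Qed.

End Morphism.

(* Equality of multisets of six elements is [perm_eq] of the sequences
   enumerating them. *)
Theorem mainTheorem3 :
  (forall n1 p q : rat, forall r : nat, (1 <= r <= 5)%N ->
     \sum_(x <- xs n1 p q) x ^+ r = \sum_(y <- ys n1 p q) y ^+ r)
  /\ ~ perm_eq (xs Xn1 Xp Xq) (ys Xn1 Xp Xq).
Proof.
split=> [n1 p q r|]; first exact: sum_xs_ys.
(* Not every specialisation separates the multisets: they coincide at
   (2, 1, 0) and (2, 3, 1), for example. At (2, 2, 1) they are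
   {+-23, +-69, +-73} and {+-81, +-47, +-43}. *)
pose v := fun i : 'I_3 => [:: 2; 2; 1]`_i : rat.
have evX k : (k < 3)%N ->
  (meval v : {rmorphism _ -> _}) 'X_(inord k) = [:: 2; 2; 1]`_k.
  by move=> lt_k3; rewrite /= mevalXU /v inordK.
move/(perm_map (meval v : {rmorphism _ -> _})).
rewrite map_xs map_ys /Xn1 /Xp /Xq (evX 0%N isT) (evX 1%N isT) (evX 2%N isT).
by vm_compute.
Qed.
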